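(* Let $\mathcal{G}=(\mathcal{N},\mathcal{E})$ be the velocity graph and $\mathcal{G}_{mp}=(\mathcal{N}_{mp},\mathcal{E}_{mp})$ the motion primitive graph built from the same ordered waypoints $w_1,\dots,w_N$ and the same $M$ sampled velocities per intermediate waypoint, where $\mathcal{G}_{mp}$ uses linear quadratic minimum-time (LQMT) motion primitives with free terminal acceleration for a triple integrator. Then $\mathcal{G}_{mp}$ has the same size as $\mathcal{G}$: $|\mathcal{N}_{mp}|=|\mathcal{N}|$ and $|\mathcal{E}_{mp}|=|\mathcal{E}|$.
   Context: Velocity graph $\mathcal{G}$: given an ordered list of waypoints $w_1,\dots,w_N\in\mathbb{R}^3$, with $M$ distinct sampled velocities in $\mathbb{R}^3$ at each intermediate waypoint and a single prescribed velocity at $w_1$ (start) and at $w_N$ (goal), the nodes are the (waypoint, velocity) pairs (nodes at different waypoint indices are different), and there is exactly one directed edge from each node at $w_i$ to each node at $w_{i+1}$, $1\le i\le N-1$, and no other edges; an edge represents the minimum-time trajectory of a control-constrained double integrator connecting the two position-velocity states. LQMT primitive for a triple integrator with free terminal acceleration: a trajectory that minimizes, over the final time $T$ and the input $u$, the cost $J=\rho T+\int_0^T \|u\|^2\,dt$ with $\rho>1$, subject to $\dddot r=u$, given initial position, velocity and acceleration, given terminal position and velocity, and unconstrained terminal acceleration. Motion primitive graph $\mathcal{G}_{mp}$ (before any pruning of infeasible or in-collision edges): by the construction used here (greedy pre-processing), a node is determined by a waypoint and one of the velocities available at that waypoint (start and goal having a single prescribed velocity); acceleration is not sampled and does not create additional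 nodes, each node carrying a single acceleration value (prescribed at the start node, otherwise resulting from an incoming primitive). From each node at $w_i$ there is exactly one edge, an LQMT primitive with free terminal acceleration, to each node at $w_{i+1}$, and there are no other edges. *)

(* Defs.v *)
From HB Require Import structures.
From mathcomp Require Import all_boot all_order all_algebra finmap.
From mathcomp Require Import all_classical all_reals all_analysis.
Set Implicit Arguments.
Unset Strict Implicit.
Unset Printing Implicit Defensive.
Import Order.TTheory GRing.Theory Num.Theory.
Import numFieldNormedType.Exports.
Local Open Scope classical_set_scope.
Local Open Scope ring_scope.

(* The library norm on ['rV[R]_3] is the sup norm; the cost uses the
   Euclidean one. *)
Definition sqnorm (R : realType) (x : 'rV[R]_3) : R :=
  \sum_(k < 3) x 0 k ^+ 2.

(* [F' = f] on [0, T] in the sense of Caratheodory: [f] is Lebesgue integrable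
   and [F] is its indefinite integral.  Discontinuous (e.g. bang-bang) inputs
   are thus allowed. *)
Definition integrates (R : realType) (T : R) (f F : R -> 'rV[R]_3) : Prop :=
  forall k : 'I_3,
    (@lebesgue_measure R).-integrable `[0, T] (fun s => (f s 0 k)%:E) /\
    forall t : R, 0 <= t <= T ->
      F t 0 k = F 0 0 k + \int[@lebesgue_measure R]_(s in `[0, t]) f s 0 k.

(* The functions below are only meaningful on [0, duration]. *)
Record double_traj (R : realType) := DoubleTraj {
  d_duration : R;
  d_pos : R -> 'rV[R]_3;
  d_vel : R -> 'rV[R]_3;
  d_ctrl : R -> 'rV[R]_3 }.

Definition double_feasible (R : realType) (U : set 'rV[R]_3)
    (p0 v0 p1 v1 : 'rV[R]_3) (x : double_traj R) : Prop :=
  let T := d_duration x in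
  [/\ 0 <= T,
      integrates T (d_vel x) (d_pos x) /\ integrates T (d_ctrl x) (d_vel x),
      (forall t, 0 <= t <= T -> U (d_ctrl x t)),
      d_pos x 0 = p0 /\ d_vel x 0 = v0
    & d_pos x T = p1 /\ d_vel x T = v1].

Definition minimum_time (R : realType) (U : set 'rV[R]_3)
    (p0 v0 p1 v1 : 'rV[R]_3) (x : double_traj R) : Prop :=
  double_feasible U p0 v0 p1 v1 x /\
  forall y, double_feasible U p0 v0 p1 v1 y -> d_duration x <= d_duration y.

Record triple_traj (R : realType) := TripleTraj {
  t_duration : R;
  t_pos : R -> 'rV[R]_3;
  t_vel : R -> 'rV[R]_3;
  t_acc : R -> 'rV[R]_3;
  t_ctrl : R -> 'rV[R]_3 }.

Definition triple_feasible (R : realType)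
    (p0 v0 a0 p1 v1 : 'rV[R]_3) (x : triple_traj R) : Prop :=
  let T := t_duration x in
  [/\ 0 <= T,
      [/\ integrates T (t_vel x) (t_pos x), integrates T (t_acc x) (t_vel x)
        & integrates T (t_ctrl x) (t_acc x)],
      [/\ t_pos x 0 = p0, t_vel x 0 = v0 & t_acc x 0 = a0]
    & t_pos x T = p1 /\ t_vel x T = v1].

(* Extended-real valued: an input that is integrable but not square integrable
   has cost [+oo]. *)
Definition lqmt_cost (R : realType) (rho : R) (x : triple_traj R) : \bar R :=
  ((rho * t_duration x)%:E +
   \int[@lebesgue_measure R]_(s in `[0%R, t_duration x])
     (sqnorm (t_ctrl x s))%:E)%E.

Definition lqmt_primitive (R : realType) (rho : R)
    (p0 v0 a0 p1 v1 : 'rV[R]_3) (x : triple_traj R) : Prop :=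
  triple_feasible p0 v0 a0 p1 v1 x /\
  forall y, triple_feasible p0 v0 a0 p1 v1 y ->
    (lqmt_cost rho x <= lqmt_cost rho y)%E.

(* Indices start at 0, so the start and the goal are the waypoints of index 0
   and N - 1. *)
Record waypoint_data (R : realType) (N M : nat) := WaypointData {
  waypoint : 'I_N -> 'rV[R]_3;
  velocities : 'I_N -> {fset 'rV[R]_3};
  card_velocities : forall i : 'I_N,
    #|` velocities i|%fset =
      if (val i == 0%N) || ((val i).+1 == N) then 1%N else M }.

(* Parallel edges are possible a priori. *)
Record digraph := Digraph {
  node : finType;
  edge : finType;
  src : edge -> node;
  tgt : edge -> node }.

(* [idx] and [vel] identify the nodes with the pairs (waypoint index, velocity
   available at that waypoint). *)
Definition nodes_are_pairs (R : realType) (N M : nat)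
    (D : waypoint_data R N M) (G : digraph)
    (idx : node G -> 'I_N) (vel : node G -> 'rV[R]_3) : Prop :=
  injective (fun n => (idx n, vel n)) /\
  forall (i : 'I_N) (v : 'rV[R]_3),
    (exists n, idx n = i /\ vel n = v) <-> v \in velocities D i.

Definition edges_join_successive (N : nat) (G : digraph)
    (idx : node G -> 'I_N) : Prop :=
  (forall e : edge G, val (idx (tgt e)) = (val (idx (src e))).+1) /\
  forall m n : node G, val (idx n) = (val (idx m)).+1 ->
    exists! e : edge G, src e = m /\ tgt e = n.

(* [U] is the set of admissible values of the control of the double
   integrator. *)
Record velocity_graph (R : realType) (N M : nat) (D : waypoint_data R N M)
    (U : set 'rV[R]_3) := VelocityGraph {
  vg_graph :> digraph;
  vg_idx : node vg_graph -> 'I_N;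
  vg_vel : node vg_graph -> 'rV[R]_3;
  vg_nodes : nodes_are_pairs D vg_idx vg_vel;
  vg_edges : edges_join_successive vg_idx;
  vg_traj : edge vg_graph -> double_traj R;
  vg_trajP : forall e,
    minimum_time U (waypoint D (vg_idx (src e))) (vg_vel (src e))
                   (waypoint D (vg_idx (tgt e))) (vg_vel (tgt e)) (vg_traj e) }.

Record motion_primitive_graph (R : realType) (N M : nat)
    (D : waypoint_data R N M) (rho : R) (a_start : 'rV[R]_3) :=
  MotionPrimitiveGraph {
  mp_graph :> digraph;
  mp_idx : node mp_graph -> 'I_N;
  mp_vel : node mp_graph -> 'rV[R]_3;
  mp_acc : node mp_graph -> 'rV[R]_3;
  mp_nodes : nodes_are_pairs D mp_idx mp_vel;
  mp_edges : edges_join_successive mp_idx;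
  mp_prim : edge mp_graph -> triple_traj R;
  mp_primP : forall e,
    lqmt_primitive rho
      (waypoint D (mp_idx (src e))) (mp_vel (src e)) (mp_acc (src e))
      (waypoint D (mp_idx (tgt e))) (mp_vel (tgt e)) (mp_prim e);
  mp_acc_start : forall n, val (mp_idx n) = 0%N -> mp_acc n = a_start;
  mp_acc_next : forall n, val (mp_idx n) <> 0%N ->
    exists e, tgt e = n /\
      mp_acc n = t_acc (mp_prim e) (t_duration (mp_prim e)) }.

(* Main.v *)
Require Import Defs.
From mathcomp Require Import all_boot all_order all_algebra finmap.
From mathcomp Require Import all_classical all_reals all_analysis.
Import Order.TTheory GRing.Theory Num.Theory.
Local Open Scope ring_scope.

(** In both graphs a node is determined by its (waypoint, velocity) pair and an
    edge by its endpoints.  Matching nodes that carry the same pair therefore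
    embeds the nodes and the edges of either graph into those of the other. *)

Lemma leq_card_waypoint_digraph {R : realType} {N M : nat}
    {D : waypoint_data R N M} {G H : digraph}
    {idxG : node G -> 'I_N} {velG : node G -> 'rV[R]_3}
    {idxH : node H -> 'I_N} {velH : node H -> 'rV[R]_3} :
  nodes_are_pairs D idxG velG -> nodes_are_pairs D idxH velH ->
  edges_join_successive idxG -> edges_join_successive idxH ->
  (#|node G| <= #|node H|)%N /\ (#|edge G| <= #|edge H|)%N.
Proof.
move=> [injG nodesG] [_ nodesH] [succG edgeG] [_ edgeH].
(* Both graphs realise exactly the pairs allowed by the same [D], so the pair of [n] transfers to
   [H] through membership in [velocities D]. *)
have /choice[f fP] n : exists m, idxH m = idxG n /\ velH m = velG n.
  by apply/nodesH/nodesG; exists n.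
have f_inj : injective f.
  move=> m n fmn; apply: injG.
  by have [<- <-] := fP m; have [<- <-] := fP n; rewrite fmn.
have /choice[g gP] (e : edge G) :
    exists e', src e' = f (src e) /\ tgt e' = f (tgt e).
  (* Since [f] preserves waypoint indices, the images of the endpoints of [e] are again
     successive. *)
  have [|e' [e'P _]] := edgeH (f (src e)) (f (tgt e)); last by exists e'.
  by rewrite (fP _).1 (fP _).1 succG.
split; first exact: leq_card f_inj.
apply: (@leq_card _ _ g) => e1 e2 g12.
have src12 : src e1 = src e2.
  by apply: f_inj; rewrite -(gP e1).1 -(gP e2).1 g12.
have tgt12 : tgt e1 = tgt e2.
  by apply: f_inj; rewrite -(gP e1).2 -(gP e2).2 g12.
(* Equal endpoints alone would allow parallel edges; uniqueness of the edge of [G] joining them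
   forces [e1 = e2]. *)
have [e [_ uniq_e]] := edgeG _ _ (succG e1).
by rewrite -(uniq_e e1) // -(uniq_e e2).
Qed.

Theorem corollary1 (R : realType) (N M : nat) (D : waypoint_data R N M)
    (U : set 'rV[R]_3) (rho : R) (hrho : 1 < rho) (a_start : 'rV[R]_3)
    (G : velocity_graph D U) (Gmp : motion_primitive_graph D rho a_start) :
  #|node Gmp| = #|node G| /\ #|edge Gmp| = #|edge G|.
Proof.
(* The comparison is one-sided, so it is applied with the graphs in both orders and closed by
   antisymmetry. *)
have [nodes_le edges_le] := leq_card_waypoint_digraph
  (mp_nodes Gmp) (vg_nodes G) (mp_edges Gmp) (vg_edges G).
have [nodes_ge edges_ge] := leq_card_waypoint_digraph
  (vg_nodes G) (mp_nodes Gmp) (vg_edges G) (mp_edges Gmp).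
by split; apply/eqP; rewrite eqn_leq ?nodes_le ?edges_le.
Qed.
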